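(* Let $L$ be a rational (two-component) link with a reduced, alternating diagram $\hat{L}$ in standard form with $m$ monochromatic twist sites, and let $\Delta(x,y)$ be its normalized two-variable Alexander polynomial. If $m=0$, then $\Delta(-1,0)=1$. If $m>0$ and the $j$-th monochromatic twist site has $\hat{q}_j$ crossings ($j=1,\dots,m$), then $$\Delta(-1,0)=\prod_{j=1}^{m}(\hat{q}_j+1).$$
   Context: **Herringbone form.** A rational tangle in herringbone form is a 2-strand tangle diagram with endpoints (posts) NW, NE, SE, SW, built from a finite sequence of twist sites, from the NW quadrant of the tangle to the SE quadrant. A horizontal (resp. vertical) twist site is a row (resp. column) of crossings between two strands. The first site, if horizontal, is obtained from two horizontal arcs by twisting the NE and SE posts around each other; if vertical, from two vertical arcs by twisting the SW and SE posts. Each later horizontal site is obtained by twisting the current NE and SE posts around each other (crossings added at the right), each later vertical site by twisting the current SW and SE posts (crossings added at the bottom). Conventions: (1) the first and last sites have at least two crossings, all others at least one; (2) sites alternate between horizontal and vertical; (3) horizontal sites are left-turning and vertical sites right-turning, so that at every crossing the overcrossing segment has positive slope and the diagram is alternating; (4) the last site is horizontal. A rational link here is a two-component link obtained as the numerator closure of such a tangle (NW joined to NE by an arc over the top, SW joined to SE by an arc under the bottom). **Numbering.** The crossings are numbered $c_1,\dots,c_n$ site by site, from left to right in horizontal sites and from top to bottom in vertical sites. The unbounded region is $r_0$ and the region enclosed by the NW/NE closing arc is $r_{n+1}$; these two adjacent regions are the starred regions. The special edge is the edge they share, namely the NW/NE closing arc, joining $c_1$ and $c_n$. **Standard form.**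 The labeled, oriented herringbone diagram is in standard form if: one component is labeled $y$, is an unknotted circle (with no self-crossings in the diagram), and contains the special edge; the other component is labeled $x$ and may or may not have self-crossings; and at $c_1$ the undercrossing strand belongs to the $y$-component and points NW, while the overcrossing strand belongs to the $x$-component and points NE. **Monochromatic sites.** A twist site is monochromatic if the strands crossing in it all have the same label; it is dichromatic if its crossings are between strands of two different labels. **Alexander polynomial.** At each crossing whose understrand has label $t\in\{x,y\}$, look along the direction of the oriented understrand and label the four quadrants: ahead-left $t$, behind-left $-t$, behind-right $1$, ahead-right $-1$. The Alexander matrix is the $n\times(n+2)$ matrix with rows indexed by crossings and columns by regions, whose entry is the label of the crossing in that region (and $0$ if they are not incident). Deleting the columns of the two starred regions and taking the determinant gives $(1-y)\Delta(x,y)$ (the special edge being labeled $y$), where $\Delta(x,y)$ is defined up to factors $\pm x^iy^j$. It is normalized so that $\Delta(x,y)$ has no negative exponents, but $x^{-1}\Delta(x,y)$ and $y^{-1}\Delta(x,y)$ do have negative exponents, and so that terms of even total degree have positive coefficients and terms of odd total degree have negative coefficients. *)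

(* Defs.v *)
From HB Require Import structures.
From mathcomp Require Export all_boot all_order all_algebra.
From mathcomp Require Export mpoly.

Set Implicit Arguments.
Unset Strict Implicit.
Unset Printing Implicit Defensive.

Import GRing.Theory Num.Theory.
Local Open Scope ring_scope.

(** * Herringbone form *)

(* [(true, q)] is a horizontal site of [q] crossings, [(false, q)] a vertical
   one. *)
Definition twist_site := (bool * nat)%type.
Definition horizontal (s : twist_site) : bool := s.1.
Definition crossings (s : twist_site) : nat := s.2.

(* The turning directions (left for horizontal sites, right for vertical ones)
   are not data: they make the overcrossing segment of every crossing the one
   of positive slope, which is built into [over] and [under_label] below. *)
Definition herringbone (T : seq twist_site) : Prop :=
  [/\ (0 < size T)%N,
      all (fun s => 1 <= crossings s)%N T,
      (2 <= crossings (head (true, 0%N) T))%N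
        /\ (2 <= crossings (last (true, 0%N) T))%N,
      sorted (fun s t => horizontal s != horizontal t) T
    & horizontal (last (true, 0%N) T)].

(** * The numerator closure as a combinatorial link diagram *)

(* Crossing ends: [(south?, east?)]. *)
Definition corner : finType := (bool * bool)%type.
Definition NW : corner := (false, false).
Definition NE : corner := (false, true).
Definition SE : corner := (true, true).
Definition SW : corner := (true, false).
Definition opposite (k : corner) : corner := (~~ k.1, ~~ k.2).
Definition over (k : corner) : bool := k.1 != k.2.

Section Diagram.
Variable T : seq twist_site.

Definition site_sizes : seq nat := map crossings T.

Definition ncross : nat := sumn site_sizes.

(* Crossings are numbered from 0: the crossing [c] is c_(c+1) of the usual
   numbering. *)
Definition site_of (c : nat) : nat := reshape_index site_sizes c.

Definition hor (c : nat) : bool :=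
  horizontal (nth (true, 0%N) T (site_of c)).

(* The crossing ends lying at the NE, SW and SE posts of the tangle made of the
   crossings 0, ..., c; the NW post is always at (0, NW). A single crossing is
   the same tangle whether it is obtained by twisting two horizontal arcs or
   two vertical arcs, so the recursion starts with the crossing 0. *)
Fixpoint postNE (c : nat) : nat * corner :=
  if c is c'.+1 then (if hor c then (c, NE) else postNE c') else (0%N, NE).

Fixpoint postSW (c : nat) : nat * corner :=
  if c is c'.+1 then (if hor c then postSW c' else (c, SW)) else (0%N, SW).

Definition postSE (c : nat) : nat * corner := (c, SE).

(* The two edges created when the crossing [c] > 0 is added. *)
Definition attach (c : nat) : seq ((nat * corner) * (nat * corner)) :=
  if hor c then [:: (postNE c.-1, (c, NW)); (postSE c.-1, (c, SW))]
  else [:: (postSW c.-1, (c, NW)); (postSE c.-1, (c, NE))].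

(* All the edges; the first one is the special edge. *)
Definition edges : seq ((nat * corner) * (nat * corner)) :=
  ((0%N, NW), postNE ncross.-1) :: (postSW ncross.-1, postSE ncross.-1)
    :: flatten [seq attach c | c <- iota 1 ncross.-1].

(** Regions are numbered 0, ..., n+1, where n = [ncross]. The unbounded region
    0 is the one to the west of the tangle, and n+1 is the one to the north,
    enclosed by the NW/NE arc. Around the crossing 0 alone, the east and south
    regions are 1 and 2; each further crossing then closes off one region and
    opens a new one, the last of which is the unbounded region again. *)
Definition new_region (c : nat) : nat := if c.+1 == ncross then 0%N else c.+2.

(* The regions to the east and to the south of the tangle made of the crossings
   0, ..., c. *)
Fixpoint east (c : nat) : nat :=
  if c is c'.+1 then (if hor c then new_region c else east c') else 1%N.

Fixpoint south (c : nat) : nat :=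
  if c is c'.+1 then (if hor c then south c' else new_region c) else 2%N.

(* The regions occupying the four quadrants of the crossing [c]. *)
Definition quadN (c : nat) : nat :=
  if (c == 0%N) || hor c then ncross.+1 else south c.-1.
Definition quadW (c : nat) : nat :=
  if (c == 0%N) || ~~ hor c then 0%N else east c.-1.
Definition quadE (c : nat) : nat := east c.
Definition quadS (c : nat) : nat := south c.

Definition cross_end : finType := ('I_ncross * corner)%type.

Definition nat_end (e : cross_end) : nat * corner := (val e.1, e.2).

Definition edge_rel (e e' : cross_end) : bool :=
  ((nat_end e, nat_end e') \in edges) || ((nat_end e', nat_end e) \in edges).

Definition through_rel (e e' : cross_end) : bool :=
  (e.1 == e'.1) && (e'.2 == opposite e.2).

Definition strand_rel : rel cross_end :=
  fun e e' => edge_rel e e' || through_rel e e'.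

Definition two_components : Prop := n_comp strand_rel predT = 2%N.

Definition alternating : Prop :=
  forall e e' : cross_end, edge_rel e e' -> over e.2 != over e'.2.

(* No crossing is nugatory, i.e. no region meets a crossing in two opposite
   quadrants. *)
Definition reduced : Prop :=
  forall c : 'I_ncross, quadN c != quadS c /\ quadE c != quadW c.

(** * Labels, orientation, standard form *)

(* The labels are the indices of the variables of [{mpoly int[2]}]. *)
Definition lx : 'I_2 := ord0.
Definition ly : 'I_2 := ord_max.

(* [lab] labels the strands; [out e] holds when the strand is oriented away
   from the crossing at the end [e]. *)
Variables (lab : cross_end -> 'I_2) (out : cross_end -> bool).

Definition component_labeling : Prop :=
  forall e e' : cross_end, (lab e == lab e') = connect strand_rel e e'.

Definition orientation : Prop :=
  forall e e' : cross_end, strand_rel e e' -> out e' = ~~ out e.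

Definition standard_form : Prop :=
  [/\ component_labeling,
      orientation,
      (* the y-component is a circle without self-crossings *)
      forall c : 'I_ncross, ~ (lab (c, NW) = ly /\ lab (c, NE) = ly),
      (* it contains the special edge, whose ends are the NW corner of the
         first crossing and the NE post of the last *)
      forall e : cross_end,
        (nat_end e = (0%N, NW)) \/ (nat_end e = postNE ncross.-1) -> lab e = ly
    & (* at the first crossing *)
      forall c : 'I_ncross, val c = 0%N ->
        [/\ lab (c, NW) = ly, out (c, NW), lab (c, NE) = lx & out (c, NE)]].

Definition monochromatic (j : nat) : bool :=
  [forall c : 'I_ncross, (site_of c == j) ==>
     [forall k : corner, [forall k' : corner, lab (c, k) == lab (c, k')]]].

(* The crossing numbers of the successive monochromatic sites. *)
Definition mono_sizes : seq nat :=
  [seq nth 0%N site_sizes j | j <- iota 0 (size T) & monochromatic j].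

(** * The Alexander polynomial *)

Definition X : {mpoly int[2]} := 'X_lx.
Definition Y : {mpoly int[2]} := 'X_ly.

(* The understrand joins the NW and SE corners. When it points NW, the quadrants
   ahead-left, behind-left, behind-right, ahead-right are W, S, E, N; when it
   points SE, they are E, N, W, S. *)
Definition under_label (c : 'I_ncross) : {mpoly int[2]} := 'X_(lab (c, NW)).

Definition entW (c : 'I_ncross) := if out (c, NW) then under_label c else 1.
Definition entS (c : 'I_ncross) := if out (c, NW) then - under_label c else -1.
Definition entE (c : 'I_ncross) := if out (c, NW) then 1 else under_label c.
Definition entN (c : 'I_ncross) := if out (c, NW) then -1 else - under_label c.

Definition alexander_matrix : 'M[{mpoly int[2]}]_(ncross, ncross.+2) :=
  \matrix_(c, r)
    (entW c *+ (quadW c == r) + entS c *+ (quadS c == r)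
     + entE c *+ (quadE c == r) + entN c *+ (quadN c == r)).

(* The columns of the starred regions 0 and n+1 are deleted. *)
Definition alexander_det : {mpoly int[2]} :=
  \det (col' ord0 (col' ord_max alexander_matrix) : 'M_ncross).

(* (1 - y) Delta is the determinant up to a factor +- x^i y^j, with i and j in
   Z; clearing denominators puts monomials on both sides. *)
Definition alexander_polynomial (Delta : {mpoly int[2]}) : Prop :=
  exists (s : bool) (i j i' j' : nat),
    (-1) ^+ s * X ^+ i * Y ^+ j * alexander_det
    = X ^+ i' * Y ^+ j' * ((1 - Y) * Delta).

(* x^-1 Delta has a negative exponent iff Delta has a term of degree 0 in x. *)
Definition normalized (Delta : {mpoly int[2]}) : Prop :=
  [/\ exists2 m : 'X_{1..2}, m \in msupp Delta & m lx = 0%N,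
      exists2 m : 'X_{1..2}, m \in msupp Delta & m ly = 0%N
    & forall m : 'X_{1..2}, m \in msupp Delta ->
        if odd (mdeg m) then Delta@_m < 0 else 0 < Delta@_m].

End Diagram.

Definition eval_xy (p : {mpoly int[2]}) (a b : int) : int :=
  p.@[fun i => if i == lx then a else b].

(* Main.v *)
Require Import Defs.
From mathcomp Require Import zify ring.

Set Implicit Arguments.
Unset Strict Implicit.
Unset Printing Implicit Defensive.

Import Order.TTheory GRing.Theory Num.Theory.
Local Open Scope ring_scope.

(** Why the theorem is true. Without the two starred columns the Alexander
    matrix is lower Hessenberg: the row of a crossing meets only the regions to
    the east and to the south of the tangle made of the previous crossings, and
    the region that the crossing opens. Hence the minors of the first rows that
    omit one column form a two-term linear recursion, with one coordinate for
    the east region and one for the south region.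

    At [x = -1], [y = 0] the row of a crossing whose understrand is labeled [x]
    becomes [W - S - E + N] up to sign, whatever the orientation, and that of a
    crossing whose understrand is labeled [y] becomes [E - N], because such an
    understrand always points NW. So the recursion depends only on the post of
    the growing tangle where the loose end of the y-strand lies; the other end
    of that strand stays at the NW post. Up to a common sign the two coordinates
    are [-a] and [b] for natural numbers [a] and [b], which evolve by
      - [(a + b, b)] at a horizontal crossing under [x],
      - [(a, a + b)] at a vertical crossing under [x],
      - [(0, b)] at a horizontal and [(0, a + b)] at a vertical crossing under
        [y] ([region_det_counters]).

    A dichromatic site moves the loose y-end to and from the SE post, where the
    counters are [(0, M)], and leaves [M] unchanged. In a monochromatic site of
    [q] crossings the y-end waits at the post that is not twisted, and one
    counter, equal to [M], is added [q] times to the other one, which turns [M]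
    into [(q + 1) M] ([tallied_iter_step]). The diagram ends with the y-end at
    the NE post after a horizontal site, where [a = M]; so the determinant at
    this point is, up to sign, the product of the [q + 1]
    ([at_point_alexander_det]).

    The determinant being nonzero at [y = 0], the unit relating it to
    [(1 - y) Delta] contains no power of [y]; and the sign rule of the
    normalization makes every term of [Delta(-1, 0)] nonnegative and at least
    one positive, so [Delta(-1, 0)] is the absolute value of that determinant
    ([at_point_alexander_polynomial], [at_point_gt0]). *)

(** * The moving strand and its two counters *)

Definition twisted (h : bool) (p : corner) : bool := if h then p.2 else p.1.

(** The exchange of the two posts that a crossing twists around each other: NE
    and SE for a horizontal one, SW and SE for a vertical one. *)
Definition twist (h : bool) (p : corner) : corner :=
  if h then (p.1 (+) p.2, p.2) else (p.1, p.1 (+) p.2).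

(** The strand arriving at this post passes under the next crossing. *)
Definition under_post (h : bool) : corner := if h then NE else SW.

(** The post holding the loose end of the y-strand, and the two counters. *)
Definition state : Type := corner * (nat * nat).

Definition step (h : bool) (s : state) : state :=
  let: (p, (a, b)) := s in
  (twist h p,
   if h then (if p == under_post h then 0%N else (a + b)%N, b)
        else (if p == under_post h then 0%N else a, (a + b)%N)).

(** The state before the first crossing, when the tangle consists of two
    horizontal arcs, or of two vertical ones; the first crossing leads from both
    to the same state. *)
Definition start (h : bool) : state := (under_post h, (0%N, 1%N)).

(** [M] is the product of the [q + 1] over the monochromatic sites so far, where
    [h] tells whether the last site was horizontal. At the NE post after a
    vertical site the counter [a] has its value of before that site, which the
    next crossing erases; at the SW post after a horizontal site the next
    crossing is vertical and puts [a + b] into [b]. *)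
Definition tallied (h : bool) (M : nat) (s : state) : Prop :=
  let: (p, (a, b)) := s in
  [\/ [/\ p = SE, a = 0%N & b = M],
      [/\ p = NE, b = M & h -> a = M]
    | [/\ p = SW, (a + b)%N = M & ~~ h -> a = 0%N]].

Lemma tallied_start h : tallied (~~ h) 1 (start h).
Proof. by case: h; [constructor 2 | constructor 3]. Qed.

(** The y-strand alternates between SE and another post: leaving SE keeps [b],
    while returning to SE erases [a] and keeps in [b] the value [M]. *)
Lemma iter_step_dichromatic h q s M :
  tallied (~~ h) M s -> twisted h s.1 -> (0 < q)%N ->
  let t := iter q (step h) s in
  t = (SE, (0%N, M)) \/ t = (under_post h, (if h then M else 0%N, M)).
Proof.
move=> inv_s tw_s; case: q => // q _; elim: q => [|q IHq].
  case: s => -[n w] [a b] in inv_s tw_s *.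
  case: inv_s tw_s => -[[-> ->]]; case: h => //= ab H _;
    [right | right | left | left]; congr (_, (_, _)); lia.
have [E | E] := IHq; rewrite iterS E; clear; case: h => /=; [right | right | left | left] => //;
  congr (_, (_, _)); lia.
Qed.

(** The y-strand stays at the post that is not twisted, and every crossing adds
    the same counter to the other one. *)
Lemma iter_step_monochromatic h q s M :
  tallied (~~ h) M s -> ~~ twisted h s.1 ->
  iter q (step h) s = (under_post (~~ h), if h then (q * M, M)%N else (M, q.+1 * M)%N).
Proof.
case: s => -[n w] [a b] inv_s tw_s.
have -> : (n, w, (a, b)) = (under_post (~~ h), (if h then 0%N else M, M)).
  by case: inv_s tw_s => -[[-> ->]]; case: h => //= ab H _;
    congr (_, (_, _)); move: (H isT); lia.
by elim: q => [|q IHq]; [| rewrite iterS IHq]; clear; case: h => //=;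
   congr (_, (_, _)); lia.
Qed.

Lemma tallied_iter_step h q s M :
  tallied (~~ h) M s -> (0 < q)%N ->
  tallied h (if twisted h s.1 then M else q.+1 * M)%N (iter q (step h) s).
Proof.
move=> inv_s q_gt0; case: ifPn => tw_s.
  have /= [->|->] := iter_step_dichromatic inv_s tw_s q_gt0; first by constructor 1.
  by case: (h); [constructor 2 | constructor 3].
rewrite (iter_step_monochromatic q inv_s tw_s).
by case: (h); [constructor 3; split=> //=; lia | constructor 2].
Qed.

(** * Sites and crossings *)

Section Sites.
Variable T : seq twist_site.

(** The state just before the crossing [c] is added. *)
Fixpoint before (c : nat) : state :=
  if c is c'.+1 then step (hor T c') (before c') else start (hor T 0).

Definition site_start (j : nat) : nat := sumn (take j (site_sizes T)).

Definition site_hor (j : nat) : bool := horizontal (nth (true, 0%N) T j).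

Definition mono_before (j : nat) : bool :=
  ~~ twisted (site_hor j) (before (site_start j)).1.

Lemma site_of_start j k :
  (k < nth 0 (site_sizes T) j)%N -> site_of T (site_start j + k) = j.
Proof. exact: flatten_indexKl. Qed.

Lemma before_site j k : (k <= nth 0 (site_sizes T) j)%N ->
  before (site_start j + k) = iter k (step (site_hor j)) (before (site_start j)).
Proof.
elim: k => [|k IHk] lt_k; first by rewrite addn0.
by rewrite addnS /= IHk ?(ltnW lt_k) // /hor site_of_start.
Qed.

Lemma site_startS j : (j < size T)%N ->
  site_start j.+1 = (site_start j + nth 0 (site_sizes T) j)%N.
Proof.
by move=> lt_j; rewrite /site_start (take_nth 0%N) ?size_map // sumn_rcons.
Qed.

Lemma crossing_of_site c : (c < ncross T)%N ->
  exists j k, [/\ (j < size T)%N, (k < nth 0 (site_sizes T) j)%N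
                & c = (site_start j + k)%N].
Proof.
move=> lt_c; exists (site_of T c), (reshape_offset (site_sizes T) c).
split; last by rewrite -[LHS](reshape_indexK (site_sizes T)).
- by rewrite -(size_map crossings) reshape_indexP.
- exact: reshape_offsetP.
Qed.

Lemma twisted_before_site j k : (k <= nth 0 (site_sizes T) j)%N ->
  twisted (site_hor j) (before (site_start j + k)).1 = ~~ mono_before j.
Proof.
move=> /before_site->; rewrite negbK; elim: k => //= k <-.
by case: (iter _ _ _) => -[n w] [a b]; case: (site_hor j).
Qed.

Hypothesis herr : herringbone T.

Lemma site_size_gt0 j : (j < size T)%N -> (0 < nth 0 (site_sizes T) j)%N.
Proof.
move=> lt_j; case: herr => _ /(all_nthP (true, 0%N))/(_ j lt_j) H _ _ _.
by rewrite (nth_map (true, 0%N)).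
Qed.

Lemma site_horS j : (j.+1 < size T)%N -> site_hor j.+1 = ~~ site_hor j.
Proof.
move=> lt_j; case: herr => _ _ _ /(sortedP (true, 0%N))/(_ j lt_j) alt _.
by move: alt; rewrite /site_hor; do 2!case: horizontal.
Qed.

Lemma last_site_hor : site_hor (size T).-1.
Proof. by case: herr => _ _ _ _; rewrite /site_hor nth_last. Qed.

Lemma ncross_gt1 : (1 < ncross T)%N.
Proof.
case: herr => + _ [+ _] _ _; case: (T) => //= s T' _; rewrite /ncross /=; lia.
Qed.

Definition mono_prod (k : nat) : nat :=
  \prod_(j <- iota 0 k | mono_before j) (nth 0 (site_sizes T) j).+1.

Lemma mono_prodS j : mono_prod j.+1 =
  (if mono_before j then (nth 0 (site_sizes T) j).+1 * mono_prod j
   else mono_prod j)%N.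
Proof.
by rewrite /mono_prod -[in LHS](addn1 j) iotaD add0n big_cat big_cons big_nil /=; case: ifP => _;
   rewrite muln1 1?mulnC.
Qed.

Lemma hor0 : hor T 0 = site_hor 0.
Proof.
have s_gt0 : (0 < size T)%N by case: herr.
have := site_of_start (site_size_gt0 s_gt0).
by rewrite /site_start take0 /hor => ->.
Qed.

(** Alternation of the sites is essential: two consecutive monochromatic sites of
    the same kind would contribute [q + q' + 1] instead of [(q + 1) (q' + 1)]. *)
Lemma tallied_site j : (j < size T)%N ->
  tallied (~~ site_hor j) (mono_prod j) (before (site_start j)).
Proof.
elim: j => [|j IHj] lt_j.
  by rewrite /site_start take0 /mono_prod big_nil /= hor0; apply: tallied_start.
rewrite site_horS // negbK site_startS ?(ltnW lt_j) // before_site //.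
rewrite mono_prodS /mono_before if_neg.
by apply: tallied_iter_step (IHj (ltnW lt_j)) (site_size_gt0 (ltnW lt_j)).
Qed.

Lemma tallied_before_ncross :
  tallied true (mono_prod (size T)) (before (ncross T)).
Proof.
have s_gt0 : (0 < size T)%N by case: herr.
have lt_j : ((size T).-1 < size T)%N by rewrite prednK.
have -> : ncross T = site_start (size T).
  by rewrite /site_start take_oversize ?size_map.
rewrite -(prednK s_gt0) site_startS // before_site // mono_prodS /mono_before if_neg.
have := tallied_iter_step (tallied_site lt_j) (site_size_gt0 lt_j).
by rewrite last_site_hor.
Qed.

Lemma hor_last : hor T (ncross T).-1.
Proof.
have s_gt0 : (0 < size T)%N by case: herr.
have lt_j : ((size T).-1 < size T)%N by rewrite prednK.
have q_gt0 := site_size_gt0 lt_j.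
have -> : (ncross T).-1 =
    (site_start (size T).-1 + (nth 0 (site_sizes T) (size T).-1).-1)%N.
  have -> : ncross T = site_start (size T).
    by rewrite /site_start take_oversize ?size_map.
  by rewrite -[in LHS](prednK s_gt0) site_startS // -[in LHS](prednK q_gt0) addnS.
by rewrite /hor site_of_start ?prednK // -/(site_hor _) last_site_hor.
Qed.

End Sites.

(** * Labels and orientations along the tangle *)

(** The corner of a new crossing to which the post [k] gets joined. *)
Definition entry (h : bool) (k : corner) : corner :=
  if h then (k.1, ~~ k.2) else (~~ k.1, k.2).

Lemma entry_under_post h : entry h (under_post h) = NW.
Proof. by case: h. Qed.

Lemma opposite_entry h k : twisted h k -> opposite (entry h k) = twist h k.
Proof. by case: h; case: k => -[] []. Qed.

Lemma twist_inj h : injective (twist h).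
Proof. by case: h => -[[] []] [[] []]. Qed.

Lemma twistK h : involutive (twist h).
Proof. by case: h => -[[] []]. Qed.

Lemma twisted_twist h k : twisted h (twist h k) = twisted h k.
Proof. by case: h; case: k => -[] []. Qed.

Lemma twist_id h k : ~~ twisted h k -> twist h k = k.
Proof. by case: h; case: k => -[] []. Qed.

Lemma twist_neq h k : twisted h k -> (twist h k == k) = false.
Proof. by case: h; case: k => -[] []. Qed.

Lemma before_pos T c : (before T c.+1).1 = twist (hor T c) (before T c).1.
Proof. by rewrite /=; case: (before T c) => -[n w] [a b]. Qed.

Section Posts.
Variable T : seq twist_site.

Definition post (k : corner) (c : nat) : nat * corner :=
  if k == NE then postNE T c else if k == SW then postSW T c else postSE c.

Lemma postS k c : k != NW ->
  post k c.+1 = if twisted (hor T c.+1) k then (c.+1, k) else post k c.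
Proof. by case: k => -[] []; rewrite /post /twisted /=; case: (hor T _). Qed.

Lemma post_crossing k c : ((post k c).1 <= c)%N.
Proof.
rewrite /post; case: ifP => _; [|case: ifP => _ //]; elim: c => //= c IHc;
  by case: ifP => // _; apply: leqW.
Qed.

Lemma edge_entry k c : (c.+1 < ncross T)%N -> twisted (hor T c.+1) k ->
  (post k c, (c.+1, entry (hor T c.+1) k)) \in edges T.
Proof.
move=> lt_c tw_k; rewrite !inE; apply/orP; right; apply/orP; right.
apply/flatten_mapP; exists c.+1; first by rewrite mem_iota; lia.
move: tw_k; rewrite /attach; case: (hor T c.+1); case: k => -[] [] //= _;
  by rewrite !inE eqxx ?orbT.
Qed.

End Posts.

Section Labels.
Variables (T : seq twist_site) (lab : cross_end T -> 'I_2) (out : cross_end T -> bool).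
Hypotheses (herr : herringbone T) (std : standard_form lab out).

Lemma strand_data e e' : strand_rel e e' -> lab e' = lab e /\ out e' = ~~ out e.
Proof.
case: std => lab_comp orient _ _ _ e_e'; split; last exact: orient.
by apply/eqP; rewrite eq_sym lab_comp connect1.
Qed.

Lemma edge_data e e' : (nat_end e, nat_end e') \in edges T ->
  lab e' = lab e /\ out e' = ~~ out e.
Proof. by move=> E; apply: strand_data; rewrite /strand_rel /edge_rel E. Qed.

Lemma through_data (i : 'I_(ncross T)) k :
  lab (i, opposite k) = lab (i, k) /\ out (i, opposite k) = ~~ out (i, k).
Proof. by apply: strand_data; rewrite /strand_rel /through_rel !eqxx orbT. Qed.

(** The strand at [e] is the y-strand exactly when [k] is the post [p], and then
    it has the stated direction. *)
Definition marks (outward : bool) (e : cross_end T) (k p : corner) : Prop :=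
  (lab e == ly) = (k == p) /\ (k == p -> out e = outward).

Definition posts_marked (c : nat) : Prop :=
  forall e k, k != NW -> nat_end e = post T k c ->
    marks false e k (before T c.+1).1.

Definition entries_marked (c : nat) : Prop :=
  forall (i : 'I_(ncross T)) k, val i = c -> twisted (hor T c) k ->
    marks true (i, entry (hor T c) k) k (before T c).1.

Lemma entries_marked0 : entries_marked 0.
Proof.
case: std => _ _ _ _ first i k i0.
have [labNW outNW labNE outNE] := first i i0.
have [labSW outSW] := through_data i NE.
rewrite /marks /=; case: (hor T 0); case: k => -[] [] //= _;
  by rewrite ?labNW ?labNE ?[lab (_, (true, false))]labSW ?labNE.
Qed.

Lemma marks_twist c i k : val i = c -> twisted (hor T c) k ->
  entries_marked c -> marks false (i, k) k (before T c.+1).1.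
Proof.
move=> ic tw_k ent; set h := hor T c in tw_k.
have tw_k' : twisted h (twist h k) by rewrite twisted_twist.
have [labk outk] := through_data i (entry h (twist h k)).
have [labp outp] := ent i _ ic tw_k'.
rewrite opposite_entry // twistK in labk outk.
have E : (k == (before T c.+1).1) = (twist h k == (before T c).1).
  by rewrite before_pos -{1}(twistK h k) (inj_eq (@twist_inj h)).
by rewrite /marks E labk outk; split=> // /outp ->.
Qed.

(** A twisted post and the corner to which it is joined are the two ends of one
    edge: same label, opposite directions. *)
Lemma entries_marked_posts c : (c.+1 < ncross T)%N ->
  posts_marked c -> entries_marked c.+1.
Proof.
move=> lt_c posts i k ic tw_k.
have k_nNW : k != NW by move: tw_k; case: (hor T _); case: k => -[] [].
have lt_p : ((post T k c).1 < ncross T)%N.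
  exact: leq_ltn_trans (post_crossing T k c) (ltnW lt_c).
pose e : cross_end T := (Ordinal lt_p, (post T k c).2).
have Ee : nat_end e = post T k c by rewrite [RHS]surjective_pairing.
have [labe oute] := posts e k k_nNW Ee.
have [|labi outi] := @edge_data e (i, entry (hor T c.+1) k).
  by rewrite Ee /nat_end /= ic edge_entry.
by split; rewrite ?labi ?outi // => /oute ->.
Qed.

Lemma posts_marked0 : posts_marked 0.
Proof.
move=> [i k'] k k_nNW E; have [i0 ->] : val i = 0%N /\ k' = k.
  by move: E k_nNW; rewrite /post; case: k => -[] [] //= [-> ->].
have [/marks_twist|] := boolP (twisted (hor T 0) k).
  by apply=> //; apply: entries_marked0.
case: std => _ _ _ _ /(_ i i0)[labNW outNW labNE outNE].
have [labSW outSW] := through_data i NE.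
rewrite before_pos /marks /=; case: (hor T 0); case: k k_nNW {E} => -[] [] //= _ _;
  by rewrite ?[lab (_, (true, false))]labSW ?labNE.
Qed.

Lemma posts_markedS c : (c.+1 < ncross T)%N ->
  posts_marked c -> posts_marked c.+1.
Proof.
move=> lt_c posts [i k'] k k_nNW; rewrite postS //; case: ifPn => [tw_k | ntw_k] E.
  case: E => ic ->; apply: marks_twist => //; exact: entries_marked_posts.
have := posts _ k k_nNW E; rewrite [(before T c.+2).1]before_pos /marks.
by rewrite -(inj_eq (@twist_inj (hor T c.+1)) k) twist_id.
Qed.

Lemma posts_marked_lt c : (c < ncross T)%N -> posts_marked c.
Proof.
elim: c => [|c IHc] lt_c; first exact: posts_marked0.
exact: posts_markedS (IHc (ltnW lt_c)).
Qed.

Lemma entries_marked_lt c : (c < ncross T)%N -> entries_marked c.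
Proof.
case: c => [|c] lt_c; first exact: entries_marked0.
exact: entries_marked_posts (posts_marked_lt (ltnW lt_c)).
Qed.

(** An understrand labeled [y] always points NW: the y-strand is directed into
    the tangle at its loose end, hence out of the NW corner of the crossing that
    is added there. *)
Lemma under_strand (i : 'I_(ncross T)) :
  let under := (before T i).1 == under_post (hor T i) in
  lab (i, NW) = (if under then ly else lx) /\ (under -> out (i, NW)).
Proof.
have tw : twisted (hor T i) (under_post (hor T i)) by case: (hor T i).
have [labi outi] := entries_marked_lt (ltn_ord i) erefl tw.
rewrite entry_under_post in labi outi.
rewrite /= eq_sym -labi; split; last by rewrite labi => /outi.
by case: eqP => // /eqP; case: (lab _) => -[|[|m]] //= lt2 _; apply/val_inj.
Qed.

(** The final NE post is an end of the special edge. *)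
Lemma before_ncross_pos : (before T (ncross T)).1 = NE.
Proof.
have n_gt1 := ncross_gt1 herr; have n_gt0 := ltnW n_gt1.
have lt_n : ((ncross T).-1 < ncross T)%N by rewrite prednK.
have lt_p : ((post T NE (ncross T).-1).1 < ncross T)%N.
  exact: leq_ltn_trans (post_crossing T NE _) lt_n.
pose e : cross_end T := (Ordinal lt_p, (post T NE (ncross T).-1).2).
have Ee : nat_end e = post T NE (ncross T).-1 by rewrite [RHS]surjective_pairing.
have [] := posts_marked_lt lt_n (isT : NE != NW) Ee; rewrite prednK // => labe _.
by case: std => _ _ _ /(_ e (or_intror Ee)) lab_e _; move: labe; rewrite lab_e => /esym/eqP.
Qed.

(** The two strands that do not carry the loose y-end are both labeled [x], so a
    crossing is monochromatic exactly when it does not twist the y-strand. *)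
Lemma one_label (i : 'I_(ncross T)) :
  [forall k : corner, forall k' : corner, lab (i, k) == lab (i, k')]
  = ~~ twisted (hor T i) (before T i).1.
Proof.
set h := hor T i; have ent := entries_marked_lt (ltn_ord i) erefl.
case: (boolP (twisted h _)) => tw_p /=.
  have [labp _] := ent _ tw_p; rewrite eqxx -/h in labp.
  have tw_p' : twisted h (twist h (before T i).1) by rewrite twisted_twist.
  have [labp' _] := ent _ tw_p'; rewrite -/h in labp'.
  apply/negP => /forallP/(_ (entry h (before T i).1))/forallP.
  move=> /(_ (entry h (twist h (before T i).1)))/eqP lab_eq.
  by move: labp'; rewrite -lab_eq labp twist_neq.
have lx_of k : lab (i, k) != ly -> lab (i, k) = lx.
  by case: (lab _) => -[|[|m]] //= lt2 _; apply/val_inj.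
have lab_ent k : twisted h k -> lab (i, entry h k) = lx.
  move=> tw_k; apply: lx_of; have [-> _] := ent _ tw_k.
  by apply: contra tw_p => /eqP <-.
have all_lx k : lab (i, k) = lx.
  (* Every corner is on one of the two strands coming from the twisted posts. *)
  have : exists2 k', twisted h k' & (k = entry h k' \/ k = opposite (entry h k')).
    case: k => -[] []; case: (h);
    [exists NE|exists SW|exists SE|exists SE|exists SE|exists SE|exists NE|exists SW] => //;
    by [left | right].
  case=> k' tw_k' [->|->]; first exact: lab_ent.
  by have [-> _] := through_data i (entry h k'); apply: lab_ent.
by apply/forallP => k; apply/forallP => k'; rewrite !all_lx.
Qed.

Lemma monochromaticE j : (j < size T)%N ->
  monochromatic lab j = mono_before T j.
Proof.
move=> lt_j; have q_gt0 := site_size_gt0 herr lt_j.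
have touch k : (k < nth 0 (site_sizes T) j)%N -> forall i : 'I_(ncross T),
    val i = (site_start T j + k)%N ->
    twisted (hor T i) (before T i).1 = ~~ mono_before T j.
  move=> lt_k i /= ->; rewrite {1}/hor site_of_start // -/(site_hor T j).
  by rewrite twisted_before_site // ltnW.
have lt0 := flatten_indexP q_gt0.
apply/forallP/idP => [mono_j | mono_j i].
  have := mono_j (Ordinal lt0).
  rewrite one_label (touch 0%N q_gt0) //= /flatten_index.
  by rewrite -/(site_start T j) site_of_start // eqxx negbK.
apply/implyP => /eqP ij; rewrite one_label.
have lt_k := reshape_offsetP (ltn_ord i : i < sumn (site_sizes T))%N.
have Ei := reshape_indexK (site_sizes T) i.
rewrite -/(site_of T i) ij in lt_k Ei.
by rewrite (touch _ lt_k) ?negbK // -[LHS]Ei.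
Qed.

Lemma prod_mono_sizes :
  (\prod_(q <- mono_sizes lab) q.+1)%N = mono_prod T (size T).
Proof.
rewrite /mono_sizes big_map big_filter /mono_prod.
rewrite big_seq_cond [RHS]big_seq_cond; apply: eq_bigl => j.
by rewrite mem_iota add0n; case: ltnP => //= /monochromaticE->.
Qed.

End Labels.

(** * Bordered Hessenberg determinants *)

Section Hessenberg.
Variables (R : comNzRingType) (M : nat -> nat -> R).

Definition bordered_det (c : nat) (v : nat -> R) : R :=
  \det (\matrix_(i < c.+1, j < c.+1) if (i < c)%N then M i j else v j).

(** The column [c.+1] has only two nonzero entries, in the last two rows. The
    minor of each is again bordered by an arbitrary last row, which is why the
    statement is about [v] rather than about leading minors of [M]. *)
Lemma bordered_detS c v : (forall i, (i < c)%N -> M i c.+1 = 0) ->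
  bordered_det c.+1 v =
    v c.+1 * bordered_det c (M c) - M c c.+1 * bordered_det c v.
Proof.
move=> M0; rewrite [LHS](expand_det_col _ ord_max) big_ord_recr big_ord_recr /=.
rewrite big1 ?add0r => [|i _]; last by rewrite mxE /= ltnW ?ltnS ?ltn_ord // M0 ?mul0r.
rewrite !mxE /= ltnSn ltnn addrC /cofactor /=.
congr (_ * _ + _).
  rewrite addnn -signr_odd odd_double mul1r; congr (\det _); apply/matrixP => i j.
  rewrite !mxE !lift_max ltn_ord; case: ltnP => // le_ci.
  by have -> : i = c :> nat by have := ltn_ord i; lia.
rewrite -mulrN addnS addnn -signr_odd /= odd_double expr1 mulN1r; congr (_ * - _).
congr (\det _); apply/matrixP => i j.
rewrite !mxE !lift_max /= /bump.
have [lt_ic | le_ci] := ltnP i c; first by rewrite add0n ltnS (ltnW lt_ic).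
by have -> : i = c :> nat; [have := ltn_ord i; lia | rewrite add1n ltnn].
Qed.

End Hessenberg.

(** * The determinant at [x = -1], [y = 0] *)

Section Determinant.
Variables (T : seq twist_site) (sgn : nat -> bool).

Local Notation n := (ncross T).

Definition y_under (c : nat) : bool := (before T c).1 == under_post (hor T c).

(** The row of the Alexander matrix at [x = -1], [y = 0]. The sign, left
    arbitrary here, records the direction of an understrand labeled [x]. *)
Definition at_point_row (c r : nat) : int :=
  if y_under c then (quadE T c == r)%:R - (quadN T c == r)%:R
  else (-1) ^+ sgn c * ((quadW T c == r)%:R - (quadS T c == r)%:R
                        - (quadE T c == r)%:R + (quadN T c == r)%:R).

Lemma east_south c : (c.+1 < n)%N ->
  [/\ (0 < east T c <= c.+2)%N, (0 < south T c <= c.+2)%N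
    & east T c != south T c].
Proof.
elim: c => //= c IHc lt_c; have [le_e le_s neq] := IHc (ltnW lt_c).
rewrite /new_region ltn_eqF //; case: (hor T _); split=> //; lia.
Qed.

Lemma quadrants_succ c : (c.+2 < n)%N ->
  [/\ quadN T c.+1 = if hor T c.+1 then n.+1 else south T c,
      quadW T c.+1 = if hor T c.+1 then east T c else 0%N,
      quadE T c.+1 = if hor T c.+1 then c.+3 else east T c
    & quadS T c.+1 = if hor T c.+1 then south T c else c.+3].
Proof.
move=> lt_c; rewrite /quadN /quadW /quadE /quadS /= /new_region ltn_eqF //.
by case: (hor T _).
Qed.

Lemma at_point_row_high c r : (c.+1 < n)%N -> (c.+2 < r <= n)%N ->
  at_point_row c r = 0.
Proof.
move=> lt_c le_r.
have [] : [/\ quadN T c != r, quadW T c != r, quadE T c != r & quadS T c != r].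
  case: c lt_c le_r => [|c] lt_c le_r.
    by rewrite /quadN /quadW /quadE /quadS /=; split; lia.
  have [-> -> -> ->] := quadrants_succ lt_c.
  have [] := east_south (ltnW lt_c); by case: (hor T _) => *; split; lia.
rewrite /at_point_row => /negPf-> /negPf-> /negPf-> /negPf->.
by case: ifP; rewrite /= ?subrr ?addr0 ?mulr0.
Qed.

(** Among the regions already open, [v] sees only those that the next crossing
    can meet. *)
Definition supported (c : nat) (v : nat -> int) : Prop :=
  forall r, (0 < r <= c.+2)%N -> r != east T c -> r != south T c -> v r = 0.

(** Columns are shifted by one: the region 0 is starred. *)
Definition region_det (c : nat) (v : nat -> int) : int :=
  bordered_det (fun i j => at_point_row i j.+1) c (fun j => v j.+1).

Lemma region_det1 v : (1 < n)%N -> region_det 1 v = v 2%N.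
Proof.
move=> n_gt1; rewrite /region_det bordered_detS //.
have y0 : y_under 0 by apply: eqxx.
rewrite /at_point_row y0 /bordered_det !det_mx11 !mxE /=.
rewrite /quadE /quadN /=.
have [-> ->] : (n.+1 == 1)%N = false /\ (n.+1 == 2)%N = false by split; lia.
by rewrite /= subrr mul0r subr0 subr0 mulr1.
Qed.

Lemma supported_row c : (c.+2 < n)%N -> supported c (at_point_row c.+1).
Proof.
move=> lt_c r le_r neq_e neq_s; have [eN eW eE eS] := quadrants_succ lt_c.
have [] : [/\ quadN T c.+1 != r, quadW T c.+1 != r, quadE T c.+1 != r & quadS T c.+1 != r].
  by rewrite eN eW eE eS; case: (hor T _); split; rewrite // 1?eq_sym //; lia.
rewrite /at_point_row => /negPf-> /negPf-> /negPf-> /negPf->.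
by case: ifP; rewrite /= ?subrr ?addr0 ?mulr0.
Qed.

(** The determinant of the first rows completed by [v] is a linear form in the
    values of [v] at the two current regions, with coefficients [-a] and [b] up
    to a common sign. Expanding it along the newest region gives the evolution of
    the counters: the new coefficient is the old linear form at the row of the
    crossing, and the surviving one is multiplied by minus the entry of that row
    in the new region. *)
Lemma region_det_counters c : (c.+1 < n)%N ->
  exists s : bool, forall v, supported c v ->
    region_det c.+1 v =
      (-1) ^+ s * ((before T c.+1).2.2%:Z * v (south T c)
                   - (before T c.+1).2.1%:Z * v (east T c)).
Proof.
elim: c => [|c IHc] lt_c.
  exists false => v _; rewrite region_det1 //= /start /=.
  by case: (hor T 0); rewrite /= mul1r mul0r subr0 mul1r.
have [s IH] := IHc (ltnW lt_c).
have [le_e le_s neq_es] := east_south (ltnW lt_c).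
have [eN eW eE eS] := quadrants_succ lt_c.
set h := hor T c.+1 in eN eW eE eS.
have eastS : east T c.+1 = if h then c.+3 else east T c := eE.
have southS : south T c.+1 = if h then south T c else c.+3 := eS.
have beforeS : before T c.+2 = step h (before T c.+1) by [].
have y_under_c : y_under c.+1 = ((before T c.+1).1 == under_post h) by [].
(* A crossing under [y] changes the common sign; one under [x] multiplies it by
   the sign of its row. *)
exists (s (+) (if y_under c.+1 then true else sgn c.+1)) => v v_supp.
rewrite /region_det bordered_detS => [|i lt_i]; last first.
  by apply: at_point_row_high; lia.
rewrite -/(region_det c.+1 (at_point_row c.+1)) -/(region_det c.+1 v).
clearbody h.
have vE : v (east T c) = if h then 0 else v (east T c.+1).
  case: (h) eastS southS => [eastS southS|-> //]; apply: v_supp; first by lia.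
    by rewrite eastS; lia.
  by rewrite southS.
have vS : v (south T c) = if h then v (south T c.+1) else 0.
  case: (h) eastS southS => [_ -> //|eastS southS]; apply: v_supp; first by lia.
    by rewrite eastS eq_sym.
  by rewrite southS; lia.
have v_new : v c.+3 = if h then v (east T c.+1) else v (south T c.+1).
  by rewrite eastS southS; case: (h).
rewrite !IH ?vE ?vS ?v_new; [| |exact: supported_row]; last first.
  move=> r le_r neq_e neq_s; apply: v_supp; first by lia.
    by rewrite eastS; case: (h) => //; lia.
  by rewrite southS; case: (h) => //; lia.
rewrite /at_point_row eN eW eE eS beforeS y_under_c.
case: (before T c.+1) => p [a b] /=.
move: (v (east T c.+1)) (v (south T c.+1)) => ve vs.
have [e_s s_n] : (east T c == south T c) = false /\ (south T c == east T c) = false by split; lia.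
have [e_n s_e] : (east T c == c.+3) = false /\ (south T c == c.+3) = false by split; lia.
have [n_e n_s] : (c.+3 == east T c) = false /\ (c.+3 == south T c) = false by split; lia.
have [N_e N_s] : (n.+1 == east T c) = false /\ (n.+1 == south T c) = false by split; lia.
have [z_e z_s] : (0 == east T c)%N = false /\ (0 == south T c)%N = false by split; lia.
have N_n : (n.+1 == c.+3) = false by lia.
have -> : (-1 : int) ^+ (s (+) (if p == under_post h then true else sgn c.+1)) =
    (-1) ^+ s * (if p == under_post h then -1 else (-1) ^+ sgn c.+1).
  by rewrite signr_addb; case: ifP.
move: ((-1) ^+ s) ((-1) ^+ sgn c.+1) => s1 s2.
by case: h {eN eW eE eS eastS southS beforeS y_under_c vE vS v_new}; case: ifP => _;
  rewrite ?e_s ?s_n ?e_n ?s_e ?n_e ?n_s ?N_e ?N_s ?z_e ?z_s ?N_n ?eqxx /=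
    ?PoszD -?[0%Z]/(0 : int) ?expr0 ?expr1; ring.
Qed.

(** The last crossing opens no new region: its east side is the unbounded,
    starred region, so its row is supported on the two current regions. *)
Lemma region_det_full c : n = c.+2 -> hor T c.+1 -> (before T c.+2).1 = NE ->
  `|region_det c.+1 (at_point_row c.+1)|%N = (before T c.+2).2.1.
Proof.
move=> nE h_last; have lt_c : (c.+1 < n)%N by rewrite nE.
have [s ->] := region_det_counters lt_c; last first.
  move=> r le_r neq_e neq_s; rewrite /at_point_row /quadN /quadW /quadE /quadS /=.
  rewrite h_last /= /new_region nE eqxx.
  have [-> [-> [-> ->]]] : (c.+3 == r) = false /\ (0 == r)%N = false
      /\ (east T c == r) = false /\ (south T c == r) = false.
    by rewrite !(eq_sym _ r); repeat split; lia.
  by case: ifP; rewrite /= ?subrr ?addr0 ?mulr0.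
have [le_e le_s neq_es] := east_south lt_c.
have -> : before T c.+2 = step true (before T c.+1) by rewrite -h_last.
rewrite /at_point_row /y_under h_last /step /under_post; case: (before T c.+1) => p [a b].
case: (p =P NE) => [->|_] //= _.
rewrite /quadN /quadW /quadE /quadS /= h_last /= /new_region nE !eqxx.
have [-> [-> [-> [-> [-> ->]]]]] : (c.+3 == east T c) = false /\ (c.+3 == south T c) = false
  /\ (0 == east T c)%N = false /\ (0 == south T c)%N = false
  /\ (east T c == south T c) = false /\ (south T c == east T c) = false.
  by repeat split; lia.
have -> : b%:Z * ((-1) ^+ sgn c.+1 * (false%:R - true%:R - false%:R + false%:R)) -
     a%:Z * ((-1) ^+ sgn c.+1 * (true%:R - false%:R - false%:R + false%:R))
   = - (-1) ^+ sgn c.+1 * (a + b)%N%:Z by rewrite /= PoszD; ring.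
by rewrite !(abszM, abszN, abszX) /= !exp1n !mul1n.
Qed.

End Determinant.

Section Specialization.
Variables (T : seq twist_site) (lab : cross_end T -> 'I_2) (out : cross_end T -> bool).
Hypotheses (herr : herringbone T) (std : standard_form lab out).

Definition at_point (p : {mpoly int[2]}) : int :=
  p.@[fun i => if i == lx then -1 else 0].

(** At [x = -1], reversing an understrand labeled [x] negates the row of its
    crossing. *)
Definition under_sign (c : nat) : bool :=
  if insub c is Some i then out (i, NW) else false.

Lemma at_point_alexander_row (i : 'I_(ncross T)) r :
  at_point (alexander_matrix lab out i r) = at_point_row T under_sign i r.
Proof.
have -> : at_point = meval (fun i => if i == lx then -1 else 0) by [].
have [labi outi] := under_strand std i.
rewrite mxE /entW /entS /entE /entN /under_label labi.
rewrite /at_point_row /y_under /under_sign valK /=.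
rewrite !rmorphD !rmorphMn /=.
case: (_ == under_post _) outi => [/(_ isT)-> | _] /=.
  rewrite !rmorphN /= !rmorph1 !mevalXU /=.
  by rewrite oppr0 !mul0rn !add0r mulNrn.
by case: (out _) => /=; rewrite !rmorphN /= !rmorph1 !mevalXU /= !mulNrn; ring.
Qed.

Lemma at_point_alexander_det :
  `|at_point (alexander_det lab out)|%N = mono_prod T (size T).
Proof.
have n_gt1 := ncross_gt1 herr; have n_gt0 := ltnW n_gt1.
have posE := before_ncross_pos herr std.
have -> : mono_prod T (size T) = (before T (ncross T)).2.1.
  have := tallied_before_ncross herr; move: posE.
  by case: (before T _) => p [a b] /= ->; case=> [[]|[_ _ /(_ isT)->]|[]].
case nE: (ncross T) n_gt1 n_gt0 posE (hor_last herr) => [|[|c]] //= _ _ posE h_last.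
rewrite -(region_det_full under_sign nE h_last posE).
congr (`| _ |)%N; rewrite /alexander_det.
have -> : at_point = meval (fun i => if i == lx then -1 else 0) by [].
rewrite -det_map_mx /region_det /bordered_det.
have : forall m (A : 'M[int]_(ncross T)) (B : 'M[int]_m) (e : m = ncross T),
    (forall i j, A (cast_ord e i) (cast_ord e j) = B i j) -> \det A = \det B.
  move=> m A B e; case: _ / e in A B * => AB; congr (\det _); apply/matrixP => i j.
  by rewrite -AB !cast_ord_id.
apply=> [|e i j]; first exact: esym nE.
rewrite [LHS]mxE 2!mxE.
rewrite [LHS]at_point_alexander_row mxE lift_max /=.
by case: ltnP => // le_ci; have -> : i = c.+1 :> nat by have := ltn_ord i; lia.
Qed.

End Specialization.

(** * Normalization *)

Lemma at_pointM p q : at_point (p * q) = at_point p * at_point q.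
Proof. exact: mevalM. Qed.

(** At [y = 0] only the terms without [y] survive; their total degree is their
    degree in [x], so the sign of the coefficient cancels that of the power of
    [-1]. One such term exists, since [y^-1 Delta] has a negative exponent. *)
Lemma at_point_gt0 (Delta : {mpoly int[2]}) :
  normalized Delta -> 0 < at_point Delta.
Proof.
case=> _ [m0 m0_supp m0_y] signs; rewrite /at_point mevalE.
have term (m : 'X_{1..2}) :
    \prod_(i < 2) (if i == lx then -1 else 0 : int) ^+ m i = (-1) ^+ m lx * 0 ^+ m ly.
  rewrite big_ord_recl big_ord1 /=; congr (_ * 0 ^+ m _); exact: val_inj.
have deg (m : 'X_{1..2}) : mdeg m = (m lx + m ly)%N.
  by rewrite mdegE big_ord_recl big_ord1; congr (_ + m _)%N; apply: val_inj.
have pos m : m \in msupp Delta -> m ly = 0%N ->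
    0 < Delta@_m * \prod_(i < 2) (if i == lx then -1 else 0 : int) ^+ m i.
  move=> m_supp m_y; rewrite term m_y expr0 mulr1 -signr_odd.
  have := signs m m_supp; rewrite deg m_y addn0.
  by case: odd => Dm; rewrite ?expr1 ?expr0 ?mulr1 // mulrN1 oppr_gt0.
rewrite (big_rem m0) //= ltr_pwDl ?pos // big_seq sumr_ge0 // => m /mem_rem m_supp.
have [m_y|] := posnP (m ly); first exact: ltW (pos m m_supp m_y).
by rewrite term lt0n expr0n => /negPf->; rewrite !mulr0.
Qed.

(** Polynomials that do not vanish at [y = 0] and differ by a power of [y] are
    equal. *)
Lemma cancel_Y j j' (p q : {mpoly int[2]}) :
  at_point p != 0 -> at_point q != 0 -> Y ^+ j * p = Y ^+ j' * q -> p = q.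
Proof.
wlog le_j : j j' p q / (j <= j')%N.
  move=> IH p0 q0 E; case: (leqP j j') => [/IH|/ltnW/IH]; first exact.
  by move=> IH'; apply/esym/IH'.
have Y0 : Y != 0.
  apply/eqP => /(congr1 (meval (fun _ => 1 : int))).
  by rewrite mevalXU meval0.
move=> p0 q0; rewrite -(subnKC le_j) exprD -mulrA => /(mulfI (expf_neq0 j Y0)).
case: (j' - j)%N => [|k]; first by rewrite mul1r.
move=> E; move: p0; rewrite E exprS -mulrA at_pointM.
by rewrite [at_point Y]mevalXU mul0r eqxx.
Qed.

Lemma at_point_alexander_polynomial T (lab : cross_end T -> 'I_2) out Delta :
  alexander_polynomial lab out Delta ->
  at_point (alexander_det lab out) != 0 -> at_point Delta != 0 ->
  `|at_point Delta|%N = `|at_point (alexander_det lab out)|%N.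
Proof.
move=> [s [i [j [i' [j' E]]]]] det0 Delta0.
have sX k : at_point ((-1) ^+ s * X ^+ k) = (-1) ^+ s * (-1) ^+ k.
  by rewrite at_pointM /at_point !(rmorphXn, rmorphN) /= rmorph1 mevalXU.
have aX k : at_point (X ^+ k) = (-1) ^+ k.
  by rewrite /at_point rmorphXn /= mevalXU.
have aY : at_point (1 - Y) = 1.
  by rewrite /at_point rmorphB /= rmorph1 mevalXU subr0.
have {}E : Y ^+ j * ((-1) ^+ s * X ^+ i * alexander_det lab out) =
           Y ^+ j' * (X ^+ i' * ((1 - Y) * Delta)).
  by rewrite [LHS]mulrCA [LHS]mulrA E [RHS]mulrCA [RHS]mulrA.
have absE (u v : int) : absz u = 1%N ->
    (u * v == 0) = (v == 0) /\ absz (u * v) = absz v.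
  by rewrite -!absz_eq0 abszM => ->; rewrite mul1n.
have abs1 k : absz ((-1) ^+ k) = 1%N by rewrite abszX exp1n.
have [] := absE ((-1) ^+ s * (-1) ^+ i) (at_point (alexander_det lab out)).
  by rewrite abszM !abs1.
rewrite -sX -at_pointM => detZ detN.
have [] := absE ((-1) ^+ i') (at_point Delta) (abs1 i').
rewrite -aX -[at_point Delta]mul1r -aY -!at_pointM => DeltaZ DeltaN.
by rewrite -DeltaN -detN (cancel_Y _ _ E) ?detZ ?DeltaZ // at_pointM aY mul1r.
Qed.

Theorem theorem3p1 (T : seq twist_site) (lab : cross_end T -> 'I_2)
    (out : cross_end T -> bool) (Delta : {mpoly int[2]}) :
  herringbone T ->
  two_components T ->
  reduced T ->
  alternating T ->
  standard_form lab out ->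
  alexander_polynomial lab out Delta ->
  normalized Delta ->
  let m := size (mono_sizes lab) in
  let q := fun j : 'I_m => nth 0%N (mono_sizes lab) j in
  (m = 0%N -> eval_xy Delta (-1) 0 = 1) /\
  ((0 < m)%N -> eval_xy Delta (-1) 0 = \prod_(j < m) ((q j)%:Z + 1)).
Proof.
move=> herr _ _ _ std alex norm m q.
have Delta_gt0 := at_point_gt0 norm.
have det_abs := at_point_alexander_det herr std.
rewrite -(prod_mono_sizes herr std) in det_abs.
have det_neq0 : at_point (alexander_det lab out) != 0.
  by rewrite -absz_eq0 det_abs -lt0n prodn_gt0.
have value : eval_xy Delta (-1) 0 = \prod_(j < m) ((q j)%:Z + 1).
  have -> : eval_xy Delta (-1) 0 = `|at_point Delta|%N%:Z by rewrite gtz0_abs.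
  rewrite (at_point_alexander_polynomial alex det_neq0 (lt0r_neq0 Delta_gt0)) det_abs.
  rewrite (big_nth 0%N) big_mkord -!natz natr_prod.
  by apply: eq_bigr => j _; rewrite -natz -addn1 natrD.
by split=> // m0; rewrite value big1 // => j; have := ltn_ord j; rewrite {2}m0.
Qed.
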